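(* Let $A\subseteq\omega$ be infinite. The following are equivalent: (i) $A$ is $\Pi^1_1$; (ii) there is a function $f:\omega\to\omega$ and an index $e$ such that $W_e^g=A$ for every function $g$ with $g(n)\ge f(n)$ for all $n$; (iii) there is a function $f:\omega\to\omega$ such that $A$ is c.e. in $g$ for every function $g$ with $g(n)\ge f(n)$ for all $n$. Likewise, the following are equivalent: (i') $A$ is $\Sigma^1_1$; (ii') there is $f$ and an index $e$ with $W_e^g=\omega\setminus A$ for every $g\ge f$; (iii') there is $f$ such that $\omega\setminus A$ is c.e. in $g$ for every $g\ge f$.
   Context: Here $g\ge f$ means $g(n)\ge f(n)$ for all $n$, and oracles $g$ are given via their graphs. $W_e^g$ denotes the $e$-th set c.e. relative to $g$. *)

(* Defs.v *)
From Stdlib Require Cantor.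
From mathcomp Require Import all_boot.
From mathcomp Require Import boolp classical_sets cardinality.
From mathcomp Require Import zify.

Set Implicit Arguments.
Unset Strict Implicit.
Unset Printing Implicit Defensive.

Local Open Scope classical_set_scope.

(* Tuples of numbers are coded by iterated Cantor pairing. *)
Notation "<| x , y |>" := (Cantor.to_nat (x, y)) (at level 0, x at level 99,
  y at level 99, format "<| x ,  y |>").

(* Kleene's partial recursive functions relative to a set oracle, presented as
   unary functions, with several arguments passed through the pairing. *)
Inductive code : Type :=
| Zero | Succ | Fst | Snd | Oracle
| Pair of code & code
| Comp of code & code
| Prec of code & code
| Mu of code.

(* [eval X c x y]: program [c] with oracle [X] halts on input [x] with
   output [y].  [Prec c d] is the function h with h(a,0) = c(a) and
   h(a,n+1) = d(a,(n,h(a,n))); [Mu c] is x |-> (mu n) [c(x,n) = 0], where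
   c(x,m) must converge for every m below the value. *)
Fixpoint eval (X : pred nat) (c : code) : nat -> nat -> Prop :=
  match c with
  | Zero => fun _ y => y = 0
  | Succ => fun x y => y = x.+1
  | Fst => fun x y => y = (Cantor.of_nat x).1
  | Snd => fun x y => y = (Cantor.of_nat x).2
  | Oracle => fun x y => y = if X x then 1 else 0
  | Pair c d => fun x y =>
      exists u v, [/\ eval X c x u, eval X d x v & y = <|u, v|>]
  | Comp c d => fun x y => exists2 u, eval X d x u & eval X c u y
  | Prec c d => fun x y =>
      let a := (Cantor.of_nat x).1 in
      (fix rec n z := match n with
        | 0 => eval X c a z
        | m.+1 => exists2 r, rec m r & eval X d <|a, <|m, r|>|> z
        end) (Cantor.of_nat x).2 y
  | Mu c => fun x y => eval X c <|x, y|> 0 /\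
      forall m, m < y -> exists v, eval X c <|x, m|> v.+1
  end.

Lemma eval_functional X c x y z : eval X c x y -> eval X c x z -> y = z.
Proof.
elim: c x y z => [||||| c IHc d IHd | c IHc d IHd | c IHc d IHd | c IHc] x y z //=.
- by move=> -> ->.
- by move=> -> ->.
- by move=> -> ->.
- by move=> -> ->.
- by move=> -> ->.
- move=> [u [v [cu dv ->]]] [u' [v' [cu' dv' ->]]].
  by rewrite (IHc _ _ _ cu cu') (IHd _ _ _ dv dv').
- by move=> [u du cu] [v dv]; rewrite -(IHd _ _ _ du dv); apply: IHc.
- elim: (Cantor.of_nat x).2 y z => [|n IHn] y z; first exact: IHc.
  by move=> [r hr dr] [s hs]; rewrite -(IHn _ _ hr hs); apply: IHd.
- move=> [c0 cS] [c0' cS']; case: (ltngtP y z) => // [/cS'|/cS] [v cv].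
  + by have := IHc _ _ _ c0 cv.
  + by have := IHc _ _ _ c0' cv.
Qed.

Fixpoint gnum (c : code) : nat :=
  match c with
  | Zero => 0
  | Succ => 1
  | Fst => 2
  | Snd => 3
  | Oracle => 4
  | Pair c d => 5 + 4 * <|gnum c, gnum d|>
  | Comp c d => 6 + 4 * <|gnum c, gnum d|>
  | Prec c d => 7 + 4 * <|gnum c, gnum d|>
  | Mu c => 8 + 4 * gnum c
  end.

Lemma gnum_inj : injective gnum.
Proof.
have E (k a b a' b' : nat) :
    k + 4 * <|a, b|> = k + 4 * <|a', b'|> -> a = a' /\ b = b'.
  move=> h; have /(Cantor.to_nat_inj (a, b) (a', b')) [-> ->] // :
    <|a, b|> = <|a', b'|> by lia.
elim=> [||||| c IHc d IHd | c IHc d IHd | c IHc d IHd | c IHc];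
  case=> [||||| c' d' | c' d' | c' d' | c'] // h;
  try (by exfalso; move: h; rewrite /= -/gnum; lia).
- by have [/IHc -> /IHd ->] := E _ _ _ _ _ h.
- by have [/IHc -> /IHd ->] := E _ _ _ _ _ h.
- by have [/IHc -> /IHd ->] := E _ _ _ _ _ h.
- by congr Mu; apply: IHc; move: h; rewrite /=; lia.
Qed.

Definition graph (g : nat -> nat) : pred nat :=
  fun z => g (Cantor.of_nat z).1 == (Cantor.of_nat z).2.

(* The domain of the [e]-th function partial recursive in (the graph of) [g];
   it is empty if [e] is not the number of a program. *)
Definition W (e : nat) (g : nat -> nat) : set nat :=
  [set x | exists c, gnum c = e /\ exists y, eval (graph g) c x y].

Definition ce_in (A : set nat) (g : nat -> nat) : Prop := exists e, W e g = A.

(* Relations between a function and a (coded tuple of) number(s) that are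
   decided by one program, uniformly in the function as an oracle. *)
Definition computable (R : (nat -> nat) -> nat -> Prop) : Prop :=
  exists c, forall h x,
    (R h x -> eval (graph h) c x 1) /\ (~ R h x -> eval (graph h) c x 0).

(* A prefix of number quantifiers applied to a computable relation. *)
Inductive arithmetical : ((nat -> nat) -> nat -> Prop) -> Prop :=
| arithmetical_computable R : computable R -> arithmetical R
| arithmetical_exists R : arithmetical R ->
    arithmetical (fun h x => exists n, R h <|x, n|>)
| arithmetical_forall R : arithmetical R ->
    arithmetical (fun h x => forall n, R h <|x, n|>).

Definition Pi11 (A : set nat) : Prop :=
  exists2 R, arithmetical R & forall x, A x <-> forall h, R h x.

Definition Sigma11 (A : set nat) : Prop :=
  exists2 R, arithmetical R & forall x, A x <-> exists h, R h x.

(* Main.v *)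
From Stdlib Require Cantor.
Require Import Defs.
From mathcomp Require Import all_boot.
From mathcomp Require Import boolp classical_sets cardinality.
From mathcomp Require Import zify.

Set Implicit Arguments.
Unset Strict Implicit.
Unset Printing Implicit Defensive.

Local Open Scope classical_set_scope.

(** Write x \notin A as "the tree of x has a path".  If f dominates a path of the
    tree of every x \notin A, then for every g >= f the part of the tree bounded
    by g has a path if and only if x \notin A; being finitely branching, it has
    no path exactly when it is finite, which is a c.e. event in g.

    Conversely, suppose that A is c.e. in every g >= f.  In Hechler forcing, a
    sufficiently generic g >= f shows that for some condition (u, n) and some
    program c no extension of (u, n) forces dom(c^g) <> A.  Then A x holds if and
    only if for every h some g extending u|n and dominating h beyond n satisfies
    x \in dom(c^g); as computations have finite use, g ranges over finite
    modifications of h, and this definition of A is Pi^1_1.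

    Both directions use resource-bounded computations relative to an oracle that
    is itself computed from another one; these also yield the normal form of
    Pi^1_1 predicates, by Skolemization.  The Sigma^1_1 half is the Pi^1_1 half
    for the complement. *)

Local Notation pi1 z := (Cantor.of_nat z).1.
Local Notation pi2 z := (Cantor.of_nat z).2.

Arguments Cantor.of_nat : simpl never.
Arguments Cantor.to_nat : simpl never.

Lemma pi1_pair x y : pi1 <|x, y|> = x.
Proof. by rewrite Cantor.cancel_of_to. Qed.

Lemma pi2_pair x y : pi2 <|x, y|> = y.
Proof. by rewrite Cantor.cancel_of_to. Qed.

Lemma pair_pi x : <|pi1 x, pi2 x|> = x.
Proof. by rewrite -surjective_pairing Cantor.cancel_to_of. Qed.

Definition piE := (pi1_pair, pi2_pair, pair_pi).

Lemma leq_pair x y x' y' : x <= x' -> y <= y' -> <|x, y|> <= <|x', y'|>.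
Proof.
by have := Cantor.to_nat_spec x y; have := Cantor.to_nat_spec x' y'; nia.
Qed.

(** * Recursive functionals *)

(** One program serves all oracles, and only total functionals are considered, so the closure
    properties below never track convergence. *)
Definition recursive (F : (nat -> nat) -> nat -> nat) : Prop :=
  exists c, forall h x, eval (graph h) c x (F h x).

Definition recursive2 (F : (nat -> nat) -> nat -> nat -> nat) : Prop :=
  recursive (fun h z => F h (pi1 z) (pi2 z)).

Definition recursive3 (F : (nat -> nat) -> nat -> nat -> nat -> nat) : Prop :=
  recursive (fun h z => F h (pi1 z) (pi1 (pi2 z)) (pi2 (pi2 z))).

Lemma recursive_ext F G :
  (forall h x, F h x = G h x) -> recursive F -> recursive G.
Proof. by move=> FG [c cF]; exists c => h x; rewrite -FG. Qed.

Lemma recursive_id : recursive (fun h x => x).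
Proof.
by exists (Pair Fst Snd) => h x; exists (pi1 x), (pi2 x); split; rewrite ?piE.
Qed.

Lemma recursive_comp F E :
  recursive F -> recursive E -> recursive (fun h x => F h (E h x)).
Proof. by move=> [c cF] [d dE]; exists (Comp c d) => h x; exists (E h x). Qed.

Lemma recursive_succ E : recursive E -> recursive (fun h x => (E h x).+1).
Proof. by apply: (@recursive_comp (fun _ x => x.+1)); exists Succ. Qed.

Lemma recursive_cst n : recursive (fun h x => n).
Proof. by elim: n => [|n /recursive_succ //]; exists Zero. Qed.

Lemma recursive_pi1 E : recursive E -> recursive (fun h x => pi1 (E h x)).
Proof. by apply: (@recursive_comp (fun _ x => pi1 x)); exists Fst. Qed.

Lemma recursive_pi2 E : recursive E -> recursive (fun h x => pi2 (E h x)).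
Proof. by apply: (@recursive_comp (fun _ x => pi2 x)); exists Snd. Qed.

Lemma recursive_pair E1 E2 : recursive E1 -> recursive E2 ->
  recursive (fun h x => <|E1 h x, E2 h x|>).
Proof.
by move=> [c cE] [d dE]; exists (Pair c d) => h x; exists (E1 h x), (E2 h x).
Qed.

Lemma recursive_app2 F E1 E2 : recursive2 F -> recursive E1 -> recursive E2 ->
  recursive (fun h x => F h (E1 h x) (E2 h x)).
Proof.
move=> rF r1 r2; have := recursive_comp rF (recursive_pair r1 r2).
by apply: recursive_ext => h x; rewrite !piE.
Qed.

Lemma recursive_iteri N B A : recursive N -> recursive3 B -> recursive A ->
  recursive (fun h x => iteri (N h x) (B h x) (A h x)).
Proof.
move=> rN [d dB] [c cA].
(* The count becomes a separate argument, since [Prec] recurses on the second component of its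
   input. *)
apply: (recursive_app2 (F := fun h x n => iteri n (B h x) (A h x))) => //;
  last exact: recursive_id.
exists (Prec c d) => h z /=.
elim: (pi2 z) => [|n IHn] /=; first exact: cA.
eexists; first exact: IHn.
have := dB h <|pi1 z, <|n, iteri n (B h (pi1 z)) (A h (pi1 z))|>|>.
by rewrite !piE.
Qed.

(** [Mu] halts at the least zero of [P]; thus a functional defined by any means is recursive once
    its values are shown to be such zeros. *)
Lemma recursive_min P F : recursive2 P ->
    (forall h x, P h x (F h x) = 0) ->
    (forall h x m, m < F h x -> P h x m != 0) ->
  recursive F.
Proof.
move=> [c cP] F0 Fmin; exists (Mu c) => h x /=; split.
  by have := cP h <|x, F h x|>; rewrite !piE F0.
move=> m /Fmin; have := cP h <|x, m|>; rewrite !piE.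
by case: (P h x m) => // v; exists v.
Qed.

Lemma recursive_if b E1 E2 : recursive (fun h x => nat_of_bool (b h x)) ->
  recursive E1 -> recursive E2 ->
  recursive (fun h x => if b h x then E1 h x else E2 h x).
Proof.
move=> rb r1 r2.
(* The conditional iterates the constant step [E1] [b] times, starting from [E2]. *)
have /(recursive_iteri rb)/(_ r2) : recursive3 (fun h x _ _ => E1 h x).
  exact/(recursive_comp r1)/recursive_pi1/recursive_id.
by apply: recursive_ext => h x; case: (b h x).
Qed.

Lemma recursive_add E1 E2 : recursive E1 -> recursive E2 ->
  recursive (fun h x => E1 h x + E2 h x).
Proof.
move=> r1 r2; have /(recursive_iteri r1)/(_ r2) : recursive3 (fun _ _ _ r => r.+1).
  by do ![apply: recursive_succ|apply: recursive_pi2|exact: recursive_id].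
by apply: recursive_ext => h x; elim: (E1 h x) => //= n ->.
Qed.

Lemma recursive_pred E : recursive E -> recursive (fun h x => (E h x).-1).
Proof.
move=> r1; have /(recursive_iteri r1)/(_ (recursive_cst 0)) :
    recursive3 (fun _ _ m _ => m).
  exact/recursive_pi1/recursive_pi2/recursive_id.
by apply: recursive_ext => h x; case: (E h x).
Qed.

Lemma recursive_sub E1 E2 : recursive E1 -> recursive E2 ->
  recursive (fun h x => E1 h x - E2 h x).
Proof.
move=> r1 r2; have /(recursive_iteri r2)/(_ r1) : recursive3 (fun _ _ _ r => r.-1).
  exact/recursive_pred/recursive_pi2/recursive_pi2/recursive_id.
apply: recursive_ext => h x; elim: (E2 h x) => [|n /= ->]; last by lia.
by rewrite subn0.
Qed.

Lemma recursive_leq E1 E2 : recursive E1 -> recursive E2 ->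
  recursive (fun h x => E1 h x <= E2 h x).
Proof.
move=> r1 r2; have := recursive_sub (recursive_cst 1) (recursive_sub r1 r2).
by apply: recursive_ext => h x; rewrite /leq; case: (E1 h x - E2 h x).
Qed.

Lemma recursive_and b1 b2 : recursive (fun h x => nat_of_bool (b1 h x)) ->
  recursive (fun h x => nat_of_bool (b2 h x)) ->
  recursive (fun h x => b1 h x && b2 h x).
Proof.
move=> r1 r2; have := recursive_if r1 r2 (recursive_cst 0).
by apply: recursive_ext => h x; case: (b1 h x).
Qed.

Lemma recursive_neg b : recursive (fun h x => nat_of_bool (b h x)) ->
  recursive (fun h x => ~~ b h x).
Proof.
move=> rb; have := recursive_sub (recursive_cst 1) rb.
by apply: recursive_ext => h x; case: (b h x).
Qed.

Lemma recursive_eq E1 E2 : recursive E1 -> recursive E2 ->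
  recursive (fun h x => E1 h x == E2 h x).
Proof.
move=> r1 r2; have := recursive_and (recursive_leq r1 r2) (recursive_leq r2 r1).
by apply: recursive_ext => h x; rewrite eqn_leq.
Qed.

Lemma recursive_graph E : recursive E -> recursive (fun h x => graph h (E h x)).
Proof. by apply: (@recursive_comp (fun h x => graph h x)); exists Oracle. Qed.

Lemma recursive_oracle E : recursive E -> recursive (fun h x => h (E h x)).
Proof.
apply: (@recursive_comp (fun h x => h x)).
(* Only the graph can be queried, so the value is found by search. *)
apply: (@recursive_min (fun h x n => ~~ graph h <|x, n|>)).
- apply/recursive_neg/recursive_graph/recursive_pair.
    exact/recursive_pi1/recursive_id.
  exact/recursive_pi2/recursive_id.
- by move=> h x; rewrite /graph !piE eqxx.
- by move=> h x m; rewrite /graph !piE => /ltn_eqF; rewrite eq_sym => ->.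
Qed.

(* The dispatch is syntactic: up to conversion [nat_of_bool] is an [if], and
   [recursive_if] would apply to its own premise. *)
Ltac recursive_tac := repeat match goal with
  | H : recursive ?F |- recursive ?F => exact: H
  | |- recursive2 _ => first [assumption | rewrite /recursive2]
  | |- recursive3 _ => first [assumption | rewrite /recursive3]
  | H : recursive2 (fun h x n => nat_of_bool (@?F h x n))
    |- recursive (fun h x => nat_of_bool (?F h _ _)) =>
    apply: (recursive_app2 H)
  | H : recursive2 ?F |- recursive (fun h x => ?F h _ _) =>
    apply: (recursive_app2 H)
  | H : recursive ?F |- recursive (fun h x => ?F h _) =>
    apply: (recursive_comp H)
  | |- recursive (fun h x => x) => exact: recursive_id
  | |- recursive (fun h x => ?n) => exact: recursive_cst
  | |- recursive (fun h x => h _) => apply: recursive_oracle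
  | |- recursive (fun h x => (_).+1) => apply: recursive_succ
  | |- recursive (fun h x => (_).-1) => apply: recursive_pred
  | |- recursive (fun h x => pi1 _) => apply: recursive_pi1
  | |- recursive (fun h x => pi2 _) => apply: recursive_pi2
  | |- recursive (fun h x => <|_, _|>) => apply: recursive_pair
  | |- recursive (fun h x => _ + _) => apply: recursive_add
  | |- recursive (fun h x => _ - _) => apply: recursive_sub
  | |- recursive (fun h x => nat_of_bool (_ <= _)) => apply: recursive_leq
  | |- recursive (fun h x => nat_of_bool (_ && _)) => apply: recursive_and
  | |- recursive (fun h x => nat_of_bool (~~ _)) => apply: recursive_neg
  | |- recursive (fun h x => nat_of_bool (_ == _)) => apply: recursive_eq
  | |- recursive (fun h x => if _ then _ else _) => apply: recursive_if
  end.

(** * Bounded search and bounded quantifiers *)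

Lemma find_iota0 (p : pred nat) s y : y <= s ->
  (forall m, m < y -> ~~ p m) -> (y < s -> p y) -> find p (iota 0 s) = y.
Proof.
move=> ys py pp; case: (ltngtP (find p (iota 0 s)) y) => // lt.
- have hs : has p (iota 0 s) by rewrite has_find size_iota; apply: leq_trans ys.
  have := nth_find 0 hs; rewrite nth_iota ?add0n; last exact: leq_trans ys.
  by rewrite (negPf (py _ lt)).
- have ys' : y < s.
    by have := find_size p (iota 0 s); rewrite size_iota; apply: leq_trans.
  by have := before_find 0 lt; rewrite nth_iota // add0n pp.
Qed.

Lemma find_iota0P (p : pred nat) s (y := find p (iota 0 s)) :
  [/\ y <= s, forall m, m < y -> ~~ p m & (y < s -> p y)].
Proof.
have ys : y <= s by have := find_size p (iota 0 s); rewrite size_iota.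
split=> // [m my|ys'].
  by have := before_find 0 my; rewrite nth_iota ?(leq_trans my) // add0n => ->.
have hs : has p (iota 0 s) by rewrite has_find size_iota.
by have := nth_find 0 hs; rewrite nth_iota.
Qed.

Lemma recursive_find (p : (nat -> nat) -> nat -> nat -> bool) N :
  recursive2 (fun h x n => nat_of_bool (p h x n)) -> recursive N ->
  recursive (fun h x => find (p h x) (iota 0 (N h x))).
Proof.
move=> rp rN.
(* This vanishes first at a hit, or at [N h x] if there is none, which is the default value of
   [find]. *)
apply: (@recursive_min (fun h x n => (n.+1 <= N h x) && ~~ p h x n)).
- recursive_tac.
- move=> h x; have [ys _ py] := find_iota0P (p h x) (N h x).
  by rewrite ltnNge; case: ltnP => //= /py ->.
- move=> h x m ltm; have [ys pm _] := find_iota0P (p h x) (N h x).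
  by rewrite (leq_trans ltm ys) pm.
Qed.

Lemma recursive_has (p : (nat -> nat) -> nat -> nat -> bool) N :
  recursive2 (fun h x n => nat_of_bool (p h x n)) -> recursive N ->
  recursive (fun h x => has (p h x) (iota 0 (N h x))).
Proof.
move=> rp rN.
apply: (@recursive_ext (fun h x => (find (p h x) (iota 0 (N h x))).+1 <= N h x)).
  by move=> h x; rewrite has_find size_iota.
by apply: recursive_leq => //; apply/recursive_succ/recursive_find.
Qed.

Lemma recursive_all (p : (nat -> nat) -> nat -> nat -> bool) N :
  recursive2 (fun h x n => nat_of_bool (p h x n)) -> recursive N ->
  recursive (fun h x => all (p h x) (iota 0 (N h x))).
Proof.
move=> rp rN.
have := @recursive_has (fun h x n => ~~ p h x n) N (recursive_neg rp) rN.
move=> /recursive_neg; apply: recursive_ext => h x; rewrite -all_predC.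
by congr nat_of_bool; apply: eq_all => n /=; rewrite negbK.
Qed.

(** * Computations with bounded resources *)

(** Partial results as numbers: [0] means no value, [v.+1] the value [v]. *)
Definition bind (u : nat) (F : nat -> nat) : nat := if u is v.+1 then F v else 0.

Lemma bindE u F y : bind u F = y.+1 -> exists2 v, u = v.+1 & F v = y.+1.
Proof. by case: u => //= v; exists v. Qed.

Lemma recursive_bind E F : recursive E -> recursive2 F ->
  recursive (fun h x => bind (E h x) (F h x)).
Proof.
move=> rE rF.
apply: (@recursive_ext (fun h x => if E h x <= 0 then 0 else F h x (E h x).-1)).
  by move=> h x; rewrite leqn0; case: (E h x).
by recursive_tac.
Qed.

(* [clock h c s x] is [y.+1] if [c] outputs [y] on [x] with every minimization
   stopping at or below [s] and every oracle query about a value of [h] at an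
   argument below [s], and [0] otherwise. *)
Fixpoint clock (h : nat -> nat) (c : code) (s x : nat) : nat :=
  match c with
  | Zero => 1
  | Succ => x.+2
  | Fst => (pi1 x).+1
  | Snd => (pi2 x).+1
  | Oracle => if pi1 x < s then (graph h x : nat).+1 else 0
  | Pair c d =>
      bind (clock h c s x) (fun u => bind (clock h d s x) (fun v => <|u, v|>.+1))
  | Comp c d => bind (clock h d s x) (clock h c s)
  | Prec c d =>
      iteri (pi2 x)
        (fun m r => bind r (fun u => clock h d s <|pi1 x, <|m, u|>|>))
        (clock h c s (pi1 x))
  | Mu c =>
      let y := find (fun n => clock h c s <|x, n|> <= 1) (iota 0 s) in
      if clock h c s <|x, y|> == 1 then y.+1 else 0
  end.

(** The search stops where [c] outputs 0 or has no output within the bound; the test [== 1] keeps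
    only a true zero. The case [y = s] occurs because [find] defaults to [s]. *)
Lemma clock_MuP h c s x y : clock h (Mu c) s x = y.+1 <->
  [/\ y <= s, clock h c s <|x, y|> = 1 &
      forall m, m < y -> 1 < clock h c s <|x, m|>].
Proof.
rewrite /=; set p := fun n => _ <= 1; split.
  have [ys pm py] := find_iota0P p s.
  case: eqP => // c1 [<-]; split=> // m /pm.
  by rewrite /p -ltnNge.
move=> [ys c1 cm].
have -> : find p (iota 0 s) = y.
  by apply: find_iota0 => // [m /cm|_]; rewrite /p ?c1 // -ltnNge.
by rewrite c1.
Qed.

Lemma clock_mono h c s t x y :
  s <= t -> clock h c s x = y.+1 -> clock h c t x = y.+1.
Proof.
move=> st; elim: c x y
  => [||||| c IHc d IHd | c IHc d IHd | c IHc d IHd | c IHc] x y //.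
- by rewrite /=; case: ltnP => // lt; rewrite (leq_trans lt st).
- by move=> /bindE[u /IHc cu /bindE[v /IHd dv <-]] /=; rewrite cu /= dv.
- by move=> /bindE[u /IHd du /IHc cu] /=; rewrite du.
- rewrite /=; elim: (pi2 x) y => [|n IHn] y /=; first exact: IHc.
  by move=> /bindE[r /IHn -> /IHd].
- move=> /clock_MuP[ys c1 cm]; apply/clock_MuP; split.
  + exact: leq_trans st.
  + exact: IHc.
  + by move=> m /cm; case E: (clock h c s _) => [|[|v]] // _; rewrite (IHc _ _ E).
Qed.

(** The use principle: a query about an argument not below [s] yields no value, whatever the
    oracle. *)
Lemma clock_local h h' c s x :
  (forall i, i < s -> h i = h' i) -> clock h c s x = clock h' c s x.
Proof.
move=> hh; elim: c x
  => [||||| c IHc d IHd | c IHc d IHd | c IHc d IHd | c IHc] x //=.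
- by rewrite /graph; case: ltnP => // lt; rewrite hh.
- by rewrite IHc IHd.
- by rewrite IHd; case: (clock h' d s x).
- by elim: (pi2 x) => //= n ->; case: (iteri _ _ _) => //= u.
- rewrite (@eq_find _ _ (fun n => clock h' c s <|x, n|> <= 1)) => [|n];
  by rewrite IHc.
Qed.

Lemma clock_sound h c s x y : clock h c s x = y.+1 -> eval (graph h) c x y.
Proof.
elim: c x y
  => [||||| c IHc d IHd | c IHc d IHd | c IHc d IHd | c IHc] x y.
- by case.
- by case.
- by case.
- by case.
- by rewrite /=; case: ltnP => // _ [<-]; case: (graph h x).
- by move=> /bindE[u /IHc cu /bindE[v /IHd dv [<-]]]; exists u, v.
- by move=> /bindE[u /IHd du /IHc cy]; exists u.
- rewrite /=; elim: (pi2 x) y => [|n IHn] y /=; first exact: IHc.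
  by move=> /bindE[r /IHn nr /IHd dy]; exists r.
- move=> /clock_MuP[_ /IHc c0 cm]; split=> // m /cm.
  by case E: (clock h c s _) => [|[|v]] // _; exists v; apply: IHc E.
Qed.

Lemma clock_complete h c x y :
  eval (graph h) c x y -> exists s, clock h c s x = y.+1.
Proof.
have mono := @clock_mono h.
elim: c x y
  => [||||| c IHc d IHd | c IHc d IHd | c IHc d IHd | c IHc] x y.
- by move=> ->; exists 0.
- by move=> ->; exists 0.
- by move=> ->; exists 0.
- by move=> ->; exists 0.
- by move=> ->; exists (pi1 x).+1; rewrite /= ltnSn; case: (graph h x).
- move=> [u [v [/IHc[s cs] /IHd[t dt] ->]]]; exists (maxn s t) => /=.
  by rewrite (mono _ _ _ _ _ (leq_maxl s t) cs) (mono _ _ _ _ _ (leq_maxr s t) dt).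
- move=> [u /IHd[s ds] /IHc[t ct]]; exists (maxn s t) => /=.
  by rewrite (mono _ _ _ _ _ (leq_maxl s t) ds) /= (mono _ _ _ _ _ (leq_maxr s t) ct).
- rewrite /=; elim: (pi2 x) {-2}(pi2 x) (leqnn (pi2 x)) y => [|n IHn] k.
    by rewrite leqn0 => /eqP-> y /IHc.
  case: k => [|k] kn y; first exact: IHc.
  move=> [r /(IHn _ kn)[s ns] /IHd[t dt]]; exists (maxn s t).
  rewrite [iteri k.+1 _ _]/=.
  (* The recursion up to [k] is itself a run of [Prec c d], on the input [<|pi1 x, k|>], so
     monotonicity raises its bound. *)
  have := mono (Prec c d) s (maxn s t) <|pi1 x, k|> r (leq_maxl _ _).
  rewrite /= !piE => /(_ ns) ->.
  by rewrite /= (mono _ _ _ _ _ (leq_maxr s t) dt).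
- move=> [/IHc[s cs] cm].
  have [t tm] : exists t, forall m, m < y -> 1 < clock h c t <|x, m|>.
    elim: y cm {cs} => [|y IHy] cm; first by exists 0.
    have [m my|t tm] := IHy; first exact/cm/ltnW.
    have [v /IHc[t' ct']] := cm _ (ltnSn y).
    exists (maxn t t') => m; rewrite ltnS leq_eqVlt => /orP[/eqP->|/tm].
      by rewrite (mono _ _ _ _ _ (leq_maxr t t') ct').
    case E: (clock h c t _) => [|w] //.
    by rewrite (mono _ _ _ _ _ (leq_maxl t t') E).
  exists (maxn y (maxn s t)); apply/clock_MuP; split; first exact: leq_maxl.
    by apply: mono cs; rewrite !leq_max leqnn orbT.
  move=> m /tm; case E: (clock h c t _) => [|w] //.
  by rewrite (mono _ _ _ _ _ _ E) // !leq_max leqnn !orbT.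
Qed.

(** [clock] is total and built from the operations above; an oracle query becomes a computation of
    [Phi]. [Phi] may depend on the input because, under [bind], iteration and search, the original
    input is one component of a larger one. *)
Lemma recursive_clock c (Phi : (nat -> nat) -> nat -> nat -> nat) S X :
  recursive2 Phi -> recursive S -> recursive X ->
  recursive (fun h x => clock (Phi h x) c (S h x) (X h x)).
Proof.
elim: c Phi S X
  => [||||| c IHc d IHd | c IHc d IHd | c IHc d IHd | c IHc] Phi S X rP rS rX /=;
  try by recursive_tac.
- by rewrite /graph; recursive_tac.
- apply: recursive_bind; first exact: IHc.
  rewrite /recursive2; apply: recursive_bind.
    by apply: (IHd (fun h z => Phi h (pi1 z))); recursive_tac.
  by recursive_tac.
- apply: recursive_bind; first exact: IHd.
  by apply: (IHc (fun h z => Phi h (pi1 z))); recursive_tac.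
- apply: recursive_iteri; [by recursive_tac| |by apply: IHc; recursive_tac].
  rewrite /recursive3; apply: recursive_bind; first by recursive_tac.
  by apply: (IHd (fun h z => Phi h (pi1 (pi1 z)))); recursive_tac.
- have rf : recursive (fun h x =>
      find (fun n => clock (Phi h x) c (S h x) <|X h x, n|> <= 1) (iota 0 (S h x))).
    apply: (@recursive_find (fun h x n => clock (Phi h x) c (S h x) <|X h x, n|> <= 1)) => //.
    apply: recursive_leq; last by recursive_tac.
    by apply: (IHc (fun h z => Phi h (pi1 z))); recursive_tac.
  apply: recursive_if; [|by recursive_tac|by recursive_tac].
  by apply: recursive_eq; [apply: IHc; recursive_tac|recursive_tac].
Qed.

(** The program of [F] is run with the least bound at which it halts; one exists because [F] is
    total. *)
Lemma recursive_subst F (Phi : (nat -> nat) -> nat -> nat -> nat) X :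
  recursive F -> recursive2 Phi -> recursive X ->
  recursive (fun h x => F (Phi h x) (X h x)).
Proof.
move=> [c cF] rP rX.
have ex h x : exists s, 0 < clock (Phi h x) c s (X h x).
  by have [s cs] := clock_complete (cF (Phi h x) (X h x)); exists s; rewrite cs.
have rS : recursive (fun h x => ex_minn (ex h x)).
  apply: (@recursive_min (fun h x s => clock (Phi h x) c s (X h x) <= 0)).
  - apply: recursive_leq; last by recursive_tac.
    by apply: (@recursive_clock c (fun h z => Phi h (pi1 z))); recursive_tac.
  - by move=> h x; case: ex_minnP => s; rewrite lt0n leqn0 => /negPf->.
  - move=> h x m; case: ex_minnP => s _ smin ms; rewrite leqNgt.
    by case: ltnP => // /smin; rewrite leqNgt ms.
have := recursive_pred (recursive_clock c rP rS rX).
apply: recursive_ext => h x; case: ex_minnP => s; case E: clock => [|y] // _ _.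
exact: eval_functional (clock_sound E) (cF _ _).
Qed.

(** * Finite sequences *)

(** Nested pairs without a stored length: every number codes an infinite sequence. *)
Definition entry (s i : nat) : nat := pi1 (iter i (fun r => pi2 r) s).

Fixpoint encode (p : nat -> nat) (k : nat) : nat :=
  if k is k'.+1 then <|p 0, encode (fun i => p i.+1) k'|> else 0.

Lemma entry_encode p k i : i < k -> entry (encode p k) i = p i.
Proof.
rewrite /entry; elim: k p i => // k IHk p [|i] ik; first by rewrite /= piE.
by rewrite iterSr /= piE IHk.
Qed.

(** This turns a quantifier over bounded finite sequences into a bounded number quantifier. *)
Lemma encode_bound p k G : (forall i, i < k -> p i <= G) ->
  encode p k <= iter k (fun r => <|G, r|>) 0.
Proof.
elim: k p => // k IHk p pG /=; apply: leq_pair; first exact: pG.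
by apply: IHk => i ik; apply: pG.
Qed.

Lemma recursive_iter N B A : recursive N -> recursive2 B -> recursive A ->
  recursive (fun h x => iter (N h x) (B h x) (A h x)).
Proof.
move=> rN rB rA.
have /(recursive_iteri rN)/(_ rA) : recursive3 (fun h x _ r => B h x r).
  by recursive_tac.
by apply: recursive_ext => h x; elim: (N h x) => //= n ->.
Qed.

Lemma recursive_entry E1 E2 : recursive E1 -> recursive E2 ->
  recursive (fun h x => entry (E1 h x) (E2 h x)).
Proof.
move=> r1 r2; apply/recursive_pi1.
by apply: (recursive_iter (B := fun _ _ r => pi2 r)); recursive_tac.
Qed.

(** * Normal form of analytic predicates *)

Lemma computable_recursive R :
  computable R -> recursive (fun h x => `[<R h x>]).
Proof.
move=> [c cR]; exists c => h x; have [c1 c0] := cR h x.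
by case: asboolP => [/c1|/c0].
Qed.

Lemma recursive_computable (b : (nat -> nat) -> nat -> bool) :
  recursive (fun h x => b h x) -> computable (fun h x => b h x).
Proof.
by move=> [c cb]; exists c => h x; have := cb h x; case: (b h x) => cx; split.
Qed.

Lemma arithmetical_not R :
  arithmetical R -> arithmetical (fun h x => ~ R h x).
Proof.
elim=> {}R.
- move=> /computable_recursive/recursive_neg/recursive_computable rR.
  apply: arithmetical_computable; move: rR; congr computable.
  by apply/funext => h; apply/funext => x; rewrite -asbool_neg asboolE.
- move=> _ /arithmetical_forall; congr arithmetical.
  by apply/funext => h; apply/funext => x; rewrite forallNE.
- move=> _ /arithmetical_exists; congr arithmetical.
  by apply/funext => h; apply/funext => x; rewrite existsNE.
Qed.

Lemma Sigma11_setC A : Sigma11 A <-> Pi11 (~` A).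
Proof.
split=> -[R aR AR]; exists (fun h x => ~ R h x).
- exact: arithmetical_not.
- by move=> x; rewrite forallNE; split=> nA /AR.
- exact: arithmetical_not.
- move=> x; rewrite existsNE; split=> [Ax /AR//|nR].
  by apply: contrapT => /AR.
Qed.

(* Skolem functions of the number quantifiers are collected into [k]. *)
Lemma arithmetical_skolem R : arithmetical R ->
  exists2 Q : (nat -> nat) -> nat -> bool, recursive (fun h x => Q h x) &
    forall h x, R h x <-> exists k, forall n, Q (fun i => <|h i, k i|>) <|x, n|>.
Proof.
elim=> {}R.
- move=> /computable_recursive rR.
  exists (fun h z => `[<R (fun i => pi1 (h i)) (pi1 z)>]).
    by apply: (@recursive_subst _ (fun h _ i => pi1 (h i)) _ rR); recursive_tac.
  move=> h x.
  have E k : (fun i => pi1 <|h i, k i|>) = h by apply/funext => i; rewrite piE.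
  split=> [Rx|[k /(_ 0) /asboolP]]; last by rewrite E piE.
  by exists (fun=> 0) => n; apply/asboolP; rewrite E piE.
- move=> _ [Q rQ RQ].
  (* The witness [n] is stored as [k 0], and the other Skolem functions are shifted by one. *)
  exists (fun h z => Q (fun i => <|pi1 (h i), pi2 (h i.+1)|>)
                       <|<|pi1 z, pi2 (h 0)|>, pi2 z|>).
    apply: (@recursive_subst _ (fun h _ i => <|pi1 (h i), pi2 (h i.+1)|>) _ rQ);
    by recursive_tac.
  move=> h x; split=> [[n /RQ[k kQ]]|[k kQ]].
    exists (fun i => if i is j.+1 then k j else n) => m; rewrite !piE.
    have -> // : (fun i => <|pi1 <|h i, if i is j.+1 then k j else n|>,
        pi2 <|h i.+1, k i|> |>) = (fun i => <|h i, k i|>).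
    by apply/funext => i; rewrite !piE.
  exists (k 0); apply/RQ; exists (fun i => k i.+1) => m.
  have := kQ m; rewrite !piE.
  have -> // : (fun i => <|pi1 <|h i, k i|>, pi2 <|h i.+1, k i.+1|> |>) =
               (fun i => <|h i, k i.+1|>).
  by apply/funext => i; rewrite !piE.
- move=> _ [Q rQ RQ].
  (* [k] packs one Skolem function for each [n], and [n] joins the final number quantifier as a
     component of a pair. *)
  exists (fun h z => Q (fun i => <|pi1 (h i), pi2 (h <|pi1 (pi2 z), i|>)|>)
                       <|<|pi1 z, pi1 (pi2 z)|>, pi2 (pi2 z)|>).
    apply: (@recursive_subst _
      (fun h z i => <|pi1 (h i), pi2 (h <|pi1 (pi2 z), i|>)|>) _ rQ);
    by recursive_tac.
  move=> h x; split=> [Rx|[k kQ] n].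
    have /choice[K KQ] n : exists k, forall m,
        Q (fun i => <|h i, k i|>) <|<|x, n|>, m|> by apply/RQ.
    exists (fun i => K (pi1 i) (pi2 i)) => m; rewrite !piE.
    have := KQ (pi1 m) (pi2 m); congr (is_true (Q _ _)).
    by apply/funext => i; rewrite !piE.
  apply/RQ; exists (fun i => k <|n, i|>) => m.
  have := kQ <|n, m|>; rewrite !piE; congr (is_true (Q _ _)).
  by apply/funext => i; rewrite !piE.
Qed.

(** After Skolemizing the negated matrix, [h] codes a function together with Skolem functions for
    its failure. [L] bounds at once the refuting [n], the minimizations and the use. Thus
    [~~ D h x L] says that [h] up to [L] lies in the tree of [x]. *)
Lemma Pi11_normal_form A : Pi11 A ->
  exists D : (nat -> nat) -> nat -> nat -> bool,
  [/\ recursive2 (fun h x L => D h x L),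
      forall x, A x <-> forall h, exists L, D h x L,
      forall h x L L', L <= L' -> D h x L -> D h x L' &
      forall h h' x L, (forall i, i < L -> h i = h' i) -> D h x L = D h' x L].
Proof.
move=> [R /arithmetical_not/arithmetical_skolem[Q [c cQ] RQ] AR].
exists (fun h x L => has (fun n => clock h c L <|x, n|> == 1) (iota 0 L)).
split.
- apply: (@recursive_has
    (fun h z n => clock h c (pi2 z) <|pi1 z, n|> == 1)); last by recursive_tac.
  apply: recursive_eq; last by recursive_tac.
  by apply: (@recursive_clock c (fun h _ => h)); recursive_tac.
- move=> x; split=> [/AR Rx h|Dx].
    have [n nQ] : exists n, ~ Q h <|x, n|>.
      apply/existsNP => hQ; have := Rx (fun i => pi1 (h i)).
      apply/(RQ (fun i => pi1 (h i)) x); exists (fun i => pi2 (h i)) => n.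
      by under eq_fun do rewrite pair_pi.
    have := cQ h <|x, n|>; move/negP/negPf: nQ => -> /clock_complete[s cs].
    exists (maxn s n.+1); apply/hasP; exists n.
      by rewrite mem_iota leq_max ltnSn orbT.
    by rewrite (clock_mono (leq_maxl _ _) cs).
  apply/AR => h; apply: contrapT => /RQ[k kQ].
  have [L /hasP[n _ /eqP/clock_sound]] := Dx (fun i => <|h i, k i|>).
  by move/(eval_functional (cQ _ _)); rewrite kQ.
- move=> h x L L' LL' /hasP[n]; rewrite mem_iota /= => nL /eqP cL.
  apply/hasP; exists n; first by rewrite mem_iota /= (leq_trans nL LL').
  by rewrite (clock_mono LL' cL).
- move=> h h' x L hh'; apply: eq_has => n.
  by rewrite (clock_local c _ hh').
Qed.

(** * Limits of sequences of finite approximations *)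

Lemma staged_choice (X : Type) (P : nat -> X -> Prop)
    (S : nat -> X -> X -> Prop) (x0 : X) : P 0 x0 ->
    (forall k x, P k x -> exists y, P k.+1 y /\ S k x y) ->
  exists2 f : nat -> X, f 0 = x0 & forall k, P k (f k) /\ S k (f k) (f k.+1).
Proof.
move=> P0 PS.
have /choice[F FP] (kx : nat * X) : exists y,
    P kx.1 kx.2 -> P kx.1.+1 y /\ S kx.1 kx.2 y.
  case: (pselect (P kx.1 kx.2)) => [/PS[y yP]|nP]; first by exists y.
  by exists x0 => /nP.
pose f := nat_rect (fun=> X) x0 (fun k x => F (k, x)).
have Pf k : P k (f k) by elim: k => //= k /(FP (k, _))[].
by exists f => // k; split=> //; have [] := FP (k, f k) (Pf k).
Qed.

Lemma prefix_limit (u : nat -> nat -> nat) (n : nat -> nat) :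
    (forall k, n k < n k.+1) ->
    (forall k i, i < n k -> u k.+1 i = u k i) ->
  exists p, forall k i, i < n k -> p i = u k i.
Proof.
move=> nn uu; have nge k : k <= n k by elim: k => // k /leq_ltn_trans; apply.
have nmono k d : n k <= n (d + k) by elim: d => // d /leq_trans; apply; apply/ltnW/nn.
have agree k d i : i < n k -> u (d + k) i = u k i.
  move=> ik; elim: d => // d <-; apply: uu; exact: leq_trans (nmono k d).
(* As [k <= n k], entry [i] is settled by stage [i.+1]. *)
exists (fun i => u i.+1 i) => k i ik; case: (leqP k i.+1) => [ki|ki].
  by rewrite -(agree k (i.+1 - k)) // subnK.
by rewrite -(agree i.+1 (k - i.+1) i (nge i.+1)) subnK // ltnW.
Qed.

(** König's lemma for the tree of functions below [g]: without a uniform [L], bad prefixes extend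
    forever to a path that contradicts the last hypothesis. *)
Lemma bounded_uniform (D : (nat -> nat) -> nat -> bool) (g : nat -> nat) :
    (forall h L L', L <= L' -> D h L -> D h L') ->
    (forall h h' L, (forall i, i < L -> h i = h' i) -> D h L = D h' L) ->
    (forall h, (forall i, h i <= g i) -> exists L, D h L) ->
  exists L, forall h, (forall i, h i <= g i) -> D h L.
Proof.
move=> Dmono Dloc Dex; apply: contrapT => noL.
(* The prefix of length [n] is bad if no [L] works for all its extensions below [g]. *)
pose bad n p := forall L, exists h,
  [/\ forall i, h i <= g i, forall i, i < n -> h i = p i & ~~ D h L].
have bad0 : bad 0 (fun=> 0).
  move=> L; apply: contrapT => nh; apply: noL; exists L => h hg.
  by apply: contrapT => /negP nD; apply: nh; exists h.
have badS n p : bad n p ->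
    exists q, bad n.+1 q /\ forall i, i < n -> q i = p i.
  move=> np; apply: contrapT => nq.
  pose upd v i := if i == n then v else p i.
  have /choice[B BD] v : exists L, forall h, (forall i, h i <= g i) ->
      (forall i, i < n -> h i = p i) -> h n = v -> D h L.
    apply: contrapT => nL; apply: nq; exists (upd v); split; last first.
      by move=> i /ltn_eqF in_; rewrite /upd in_.
    move=> L; apply: contrapT => nh; apply: nL; exists L => h hg hp hv.
    apply: contrapT => /negP nD; apply: nh; exists h; split=> // i.
    rewrite ltnS leq_eqVlt /upd => /orP[/eqP-> |ltin]; first by rewrite eqxx.
    by rewrite (ltn_eqF ltin) hp.
  (* Finite branching: only [g n + 1] values are possible at [n], so the bounds [B v] have a
     maximum. *)
  have [h [hg hp /negP]] := np (\max_(v < (g n).+1) B v); apply.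
  apply: Dmono (BD (h n) h hg hp erefl).
  by apply: (leq_bigmax (F := fun v : 'I__ => B v) (Ordinal (hg n : h n < (g n).+1))).
have [u _ uP] := staged_choice bad0 badS.
have [k|k i|p pu] := @prefix_limit u id.
- exact: ltnSn.
- by have [_] := uP k; apply.
have pg i : p i <= g i.
  have [/(_ 0)[h [hg hp _]] _] := uP i.+1.
  by rewrite (pu i.+1) // -hp.
have [L DL] := Dex p pg; have [/(_ L)[h [_ hp /negP nD]] _] := uP L; apply: nD.
by rewrite (Dloc h p) // => i iL; rewrite (pu L) ?hp.
Qed.

(** * Domains of programs *)

Definition dom (c : code) (g : nat -> nat) : set nat :=
  [set x | exists y, eval (graph g) c x y].

Lemma W_gnum c g : W (gnum c) g = dom c g.
Proof.
apply/seteqP; split=> x; first by move=> [d [/gnum_inj -> [y cy]]]; exists y.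
by move=> [y cy]; exists c; split=> //; exists y.
Qed.

Lemma ce_in_dom A g : ce_in A g -> exists c, dom c g = A.
Proof.
move=> [e eA]; have [[c ce]|nc] := pselect (exists c, gnum c = e).
  by exists c; rewrite -W_gnum ce.
(* [Mu Succ] never halts, matching the empty [W e] when [e] is not the number of a program. *)
exists (Mu Succ); rewrite -eA; apply/seteqP; split=> x; first by case=> y [].
by move=> [c [ce _]]; case: nc; exists c.
Qed.

Lemma dom_clock c g x : dom c g x <-> exists s, 0 < clock g c s x.
Proof.
split=> [[y /clock_complete[s cs]]|[s]]; first by exists s; rewrite cs.
by case E: (clock g c s x) => [|y] // _; exists y; apply: clock_sound E.
Qed.

Lemma dom_search (T : (nat -> nat) -> nat -> nat -> bool) :
  recursive2 (fun g x n => T g x n) ->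
  exists c, forall g x, dom c g x <-> exists n, T g x n.
Proof.
move=> /recursive_neg[c cT]; exists (Mu c) => g x.
have cE n : eval (graph g) c <|x, n|> (~~ T g x n) by have := cT g <|x, n|>; rewrite !piE.
split=> [[y [/(eval_functional (cE y)) Ty _]]|ex].
  by exists y; move: Ty; case: (T g x y).
exists (ex_minn ex); case: ex_minnP => n Tn nmin; split.
  by have := cE n; rewrite Tn.
move=> m mn; exists 0; have := cE m; case Tm: (T g x m) => //.
by have := nmin _ Tm; rewrite leqNgt mn.
Qed.

(** * From analytic definitions to uniform enumerations *)

Lemma Pi11_uniform_ce A : Pi11 A ->
  exists f c, forall g, (forall n, f n <= g n) -> dom c g = A.
Proof.
move=> /Pi11_normal_form[D [rD AD Dmono Dloc]].
have /choice[p pD] x : exists p, ~ A x -> forall L, ~~ D p x L.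
  have [Ax|nA] := pselect (A x); first by exists id.
  have /existsNP[p /forallNP pD] : ~ forall h, exists L, D h x L by move/AD.
  by exists p => _ L; apply/negP.
(* Clipping puts every code inside the box bounded by [g (x + i)], so all codes below a bound can be
   tested without filtering. *)
pose clip (g : nat -> nat) x s i := minn (entry s i) (g (x + i)).
pose total (g : nat -> nat) x L := iteri L (fun i r => g (x + i) + r) 0.
(* [total] bounds all entries at positions below [L], so by [encode_bound] the codes below [bnd]
   cover the whole box up to [L]. *)
pose bnd g x L := (iter L (fun r => <|total g x L, r|>) 0).+1.
pose T g x L := all (fun s => D (clip g x s) x L) (iota 0 (bnd g x L)).
have [c cT] : exists c, forall g x, dom c g x <-> exists L, T g x L.
  apply: dom_search.
  apply: (@recursive_all (fun g z s => D (clip g (pi1 z) s) (pi1 z) (pi2 z))).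
    apply: (@recursive_subst _ (fun g w => clip g (pi1 (pi1 w)) (pi2 w))
      (fun _ w => pi1 w) rD); last by recursive_tac.
    rewrite /recursive2 /clip /minn.
    by apply: recursive_if; first apply: recursive_leq; first apply: recursive_succ;
      try apply: recursive_entry; recursive_tac.
  apply/recursive_succ.
  apply: (recursive_iter (B := fun g z r => <|total g (pi1 z) (pi2 z), r|>));
    try by recursive_tac.
  apply: recursive_pair; last by recursive_tac.
  by apply: (recursive_iteri (B := fun g z i r => g (pi1 (pi1 z) + i) + r)); recursive_tac.
(* Reading the bound at [x + i] lets one function dominate the paths of all [x]: both indices are at
   most [x + i]. *)
exists (fun n => \max_(x < n.+1) \max_(i < n.+1) p x i), c => g fg.
have pg x i : p x i <= g (x + i).
  apply: leq_trans (fg _).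
  have xi : x < (x + i).+1 by rewrite ltnS leq_addr.
  have ix : i < (x + i).+1 by rewrite ltnS leq_addl.
  apply: leq_trans (leq_bigmax (F := fun x : 'I__ => \max_(i < _) p x i) (Ordinal xi)).
  exact: (leq_bigmax (F := fun i : 'I__ => p x i) (Ordinal ix)).
apply/seteqP; split=> x.
  (* If [x] were outside [A], its path [p x], cut at [L], would be among the tested sequences and
     fail the test. *)
  move=> /cT[L /allP TL]; apply: contrapT => /pD/(_ L)/negP; apply.
  have tot i : i < L -> g (x + i) <= total g x L.
    rewrite /total; elim: L {TL} => // L IHL.
    rewrite ltnS leq_eqVlt /= => /orP[/eqP->|/IHL]; first exact: leq_addr.
    by move/leq_trans; apply; apply: leq_addl.
  rewrite -(Dloc (clip g x (encode (p x) L))); last first.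
    by move=> i iL; rewrite /clip entry_encode //; apply/minn_idPl.
  apply: TL; rewrite mem_iota /= add0n ltnS; apply: encode_bound => i iL.
  exact: leq_trans (pg x i) (tot i iL).
move=> /AD Dx; apply/cT.
have [L DL] := @bounded_uniform (fun h L => D h x L) (fun i => g (x + i))
  (fun h => @Dmono h x) (fun h h' L => @Dloc h h' x L) (fun h _ => Dx h).
by exists L; apply/allP => s _; apply: DL => i; apply: geq_minr.
Qed.

(** * From enumerations to analytic definitions *)

(** A Hechler condition; [u] supplies both the stem, of length [n], and the function to dominate. *)
Definition cone (u : nat -> nat) (n : nat) : set (nat -> nat) :=
  [set g | (forall i, i < n -> g i = u i) /\ forall i, u i <= g i].

(** Otherwise every condition extends, for each program [c], to one forcing [dom c g <> A]. Meeting
    these requirements in the order of program numbers gives [g] above [f] in which [A] is not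
    c.e. *)
Lemma exists_cone_dense_dom A f : (forall g, (forall n, f n <= g n) -> ce_in A g) ->
  exists c u n, forall v m, n <= m -> cone u n v ->
    exists2 g, cone v m g & dom c g = A.
Proof.
move=> fA; apply: contrapT => ncone.
have step k (un : (nat -> nat) * nat) : True -> exists vm : (nat -> nat) * nat,
    True /\ [/\ un.2 < vm.2, cone un.1 un.2 vm.1 &
      forall c g, gnum c = k -> cone vm.1 vm.2 g -> dom c g <> A].
  case: un => u n _ /=.
  have [[c ck]|nc] := pselect (exists c, gnum c = k); last first.
    exists (u, n.+1); split=> //; split=> // c g ck; by case: nc; exists c.
  apply: contrapT => nvm; apply: ncone; exists c, u, n => v m nm uv.
  (* The stem grows by one so that lengths strictly increase; the cone only shrinks. *)
  apply: contrapT => ng; apply: nvm; exists (v, m.+1); split=> //; split=> //.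
  move=> d g; rewrite -ck => /gnum_inj -> [gv vg] dA; apply: ng; exists g => //.
  by split=> // i im; apply/gv/ltnW.
have [F F0 FS] := @staged_choice _ (fun _ _ => True) _ (f, 0) I step.
have [k|k i|g gF] := @prefix_limit (fun k => (F k).1) (fun k => (F k).2).
- by have [_ []] := FS k.
- by have [_ [_ [+ _] _]] := FS k; apply.
have Fmono k d i : (F k).1 i <= (F (d + k)).1 i.
  elim: d => // d /leq_trans; apply.
  by have [_ [_ [_ +] _]] := FS (d + k); apply.
have Fge k : k <= (F k).2.
  elim: k => // k /leq_ltn_trans; apply; by have [_ []] := FS k.
have gcone k : cone (F k).1 (F k).2 g.
  split=> [i|i]; first exact: gF.
  (* A stage whose stem contains [i] and which comes after [k] gives the domination at [i]. *)
  rewrite (gF (i.+1 + k)) //; apply: leq_trans (Fge _); exact: leq_addr.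
have /ce_in_dom[c] : ce_in A g.
  by apply: fA => n; have [_ /(_ n)] := gcone 0; rewrite F0.
by have [_ [_ _ /(_ c g erefl)]] := FS (gnum c); apply.
Qed.

Lemma Pi11_of_ce A f :
  (forall g, (forall n, f n <= g n) -> ce_in A g) -> Pi11 A.
Proof.
move=> /exists_cone_dense_dom[c [u [n gen]]].
(* By finite use, a halting run with oracle [g] survives in some [g'] that agrees with [g] up to the
   use and satisfies [dom c g' = A]. *)
have domA g x : cone u n g -> dom c g x -> A x.
  move=> ug /dom_clock[s cs].
  have [g' [gg' _] <-] := gen g (maxn n s) (leq_maxl _ _) ug.
  apply/dom_clock; exists s; rewrite (@clock_local _ g) // => i si.
  by rewrite gg' // leq_max si orbT.
(* The stem of [u], then [h] raised by the finite correction coded in [t]; a number quantifier over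
   [t] thus replaces one over functions above [h]. *)
pose Phi (h : nat -> nat) t i :=
  if i < n then entry (encode u n) i else h i + entry t i.
exists (fun h x => exists t, exists s, 0 < clock (Phi h t) c s x).
  have : arithmetical (fun h z =>
      0 < clock (Phi h (pi2 (pi1 z))) c (pi2 z) (pi1 (pi1 z))).
    apply/arithmetical_computable/recursive_computable.
    apply: recursive_leq; first by recursive_tac.
    apply: (@recursive_clock c (fun h z => Phi h (pi2 (pi1 z))));
      try by recursive_tac.
    rewrite /recursive2 /Phi; apply: recursive_if; first by recursive_tac.
      by apply: recursive_entry; recursive_tac.
    by apply: recursive_add; [|apply: recursive_entry]; recursive_tac.
  move=> /arithmetical_exists/arithmetical_exists; congr arithmetical.
  apply/funext => h; apply/funext => x; congr ex; apply/funext => t.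
  by congr ex; apply/funext => s; rewrite !piE.
(* For the converse the instance [h = u] suffices, since [Phi u t] lies in the cone. *)
move=> x; split=> [Ax h|/(_ u)[t [s cs]]].
  pose v i := if i < n then u i else maxn (u i) (h i).
  have uv : cone u n v.
    split=> i; rewrite /v; first by move=> ->.
    by case: ifP => // _; apply: leq_maxl.
  have [g [gv vg] domg] := gen v n (leqnn n) uv.
  have /dom_clock[s cs] : dom c g x by rewrite domg.
  (* Beyond the stem [g] dominates [h], so the truncated difference is exact there; values from [s]
     on do not affect the run. *)
  exists (encode (fun i => g i - h i) s), s.
  rewrite (@clock_local _ g) // => i si; rewrite /Phi.
  have := vg i; rewrite /v; case: ltnP => [ltin _|_].
    by rewrite entry_encode // gv // /v ltin.
  by rewrite entry_encode // geq_max => /andP[_ /subnKC].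
apply: (domA (Phi u t)); last by apply/dom_clock; exists s.
split=> i; rewrite /Phi; first by move=> ltin; rewrite ltin entry_encode.
by case: ltnP => [ltin|_]; [rewrite entry_encode|apply: leq_addr].
Qed.

(** * The equivalences for both classes *)

Lemma Pi11_uniform_ceP (A : set nat) :
  (Pi11 A <->
     exists (f : nat -> nat) (e : nat),
       forall g : nat -> nat, (forall n, f n <= g n) -> W e g = A) /\
  (Pi11 A <->
     exists f : nat -> nat,
       forall g : nat -> nat, (forall n, f n <= g n) -> ce_in A g).
Proof.
have uni : Pi11 A -> exists f e, forall g, (forall n, f n <= g n) -> W e g = A.
  move=> /Pi11_uniform_ce[f [c fc]]; exists f, (gnum c) => g /fc.
  by rewrite W_gnum.
split; split=> [|[f]].
- exact: uni.
- by move=> [e fe]; apply: (@Pi11_of_ce _ f) => g /fe; exists e.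
- by move=> /uni[f [e fe]]; exists f => g /fe; exists e.
- exact: Pi11_of_ce.
Qed.

Theorem theorem2p1 (A : set nat) (Ainf : infinite_set A) :
  ((Pi11 A <->
     exists (f : nat -> nat) (e : nat),
       forall g : nat -> nat, (forall n, f n <= g n) -> W e g = A) /\
   (Pi11 A <->
     exists f : nat -> nat,
       forall g : nat -> nat, (forall n, f n <= g n) -> ce_in A g)) /\
  ((Sigma11 A <->
     exists (f : nat -> nat) (e : nat),
       forall g : nat -> nat, (forall n, f n <= g n) -> W e g = ~` A) /\
   (Sigma11 A <->
     exists f : nat -> nat,
       forall g : nat -> nat, (forall n, f n <= g n) -> ce_in (~` A) g)).
Proof.
split; first exact: Pi11_uniform_ceP.
have [u nu] := Pi11_uniform_ceP (~` A).
by split; [apply: iff_trans u | apply: iff_trans nu]; apply: Sigma11_setC.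
Qed.
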